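(* Let $H:(0,\infty)\to\mathbb{R}$ be a differentiable function with derivative $H'$. There exist functions $\lambda,\mu:(0,\infty)\to\mathbb{R}$ such that the variational equation $$H'(m_x m_y)=\lambda(m_x)+\mu(m_y)$$ holds for all positive $m_x$ and $m_y$ if and only if there are constants $A,B,C\in\mathbb{R}$ such that $$H(m)=A+Bm+C\,(m\log m-m)\qquad\text{for all }m>0.$$
   Context: Here $\log$ is the natural logarithm. The function $H$ is assumed only to be differentiable (once); no continuity is assumed of $H'$, $\lambda$ or $\mu$. *)

(* Defs.v *)
From Stdlib Require Export Reals.
From Coquelicot Require Export Coquelicot.

(* Functions on (0,+oo) are rendered as total functions R -> R of which only
   the values at positive arguments are ever constrained or used. As (0,+oo)
   is open, differentiability at m > 0 depends only on those values. *)
Definition has_derivative_on_pos (H H' : R -> R) : Prop :=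
  forall m : R, (0 < m)%R -> is_derive H m (H' m).

(* Main.v *)
Require Import Defs.
From Stdlib Require Import Reals Lra.
From Coquelicot Require Import Coquelicot.
Open Scope R_scope.

(** The variational equation is a Cauchy equation in multiplicative form:
    eliminating [lambda] and [mu] gives [f (x * y) = f x + f y - f 1] for
    [f = H'].  No regularity of [f] is assumed, but [f] is a derivative, and
    this is enough.  For fixed [y], integrating the equation in [x] from [1]
    to [2] expresses [f y] through the values of [H] at [y] and [2 * y], so
    that [f] is itself differentiable ([log_additive_derivative_formula]).
    Differentiating the equation in [x] at [x = 1] then gives
    [f' y = f' 1 / y], whence [f = f 1 + f' 1 * ln]
    ([log_additive_differentiable]).  The primitives of this function are the
    functions [A + B * m + C * (m * ln m - m)], which also yields the
    converse. *)

Lemma has_derivative_on_pos_unique_primitive (F G f : R -> R) :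
  has_derivative_on_pos F f -> has_derivative_on_pos G f ->
  forall x y : R, 0 < x -> 0 < y -> F x - G x = F y - G y.
Proof.
  intros hF hG.
  assert (lt_case : forall x y, 0 < x -> x < y -> F x - G x = F y - G y).
  { intros x y hx hxy.
    apply (eq_is_derive (fun t => F t - G t)); [|exact hxy].
    intros t ht.
    assert (ht0 : 0 < t) by lra.
    assert (d := is_derive_minus F G t _ _ (hF t ht0) (hG t ht0)).
    rewrite minus_eq_zero in d; exact d. }
  intros x y hx hy.
  destruct (Rtotal_order x y) as [h | [-> | h]].
  - now apply lt_case.
  - reflexivity.
  - symmetry; now apply lt_case.
Qed.

Lemma is_derive_dilate (F : R -> R) (y x l : R) :
  is_derive F (x * y) l -> is_derive (fun t => F (t * y)) x (y * l).
Proof.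
  intros hF.
  apply (is_derive_comp F (fun t => t * y)); [exact hF|].
  auto_derive; [exact I | ring].
Qed.

Lemma has_derivative_on_pos_affine_log (A B C : R) :
  has_derivative_on_pos (fun m => A + B * m + C * (m * ln m - m))
    (fun m => B + C * ln m).
Proof.
  intros m hm.
  auto_derive; [exact hm | field; lra].
Qed.

(** For fixed [y], both [x |-> H (x * y)] and
    [x |-> y * (H x + (f y - f 1) * x)] are primitives of [x |-> y * f (x * y)],
    so they have the same increment between [1] and [2]. *)
Lemma log_additive_derivative_formula (H f : R -> R) :
  has_derivative_on_pos H f ->
  (forall x y, 0 < x -> 0 < y -> f (x * y) = f x + f y - f 1) ->
  forall y, 0 < y ->
    f y = (H (2 * y) - H y) / y + (f 1 - H 2 + H 1).
Proof.
  intros hH hf y hy.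
  assert (incr := has_derivative_on_pos_unique_primitive
    (fun x => H (x * y)) (fun x => y * (H x + (f y - f 1) * x))
    (fun x => y * f (x * y))).
  assert (e : H (2 * y) - y * (H 2 + (f y - f 1) * 2)
            = H (1 * y) - y * (H 1 + (f y - f 1) * 1)).
  { apply incr; try lra.
    - intros x hx.
      apply is_derive_dilate, hH.
      now apply Rmult_lt_0_compat.
    - intros x hx.
      rewrite (hf x y hx hy).
      replace (f x + f y - f 1) with (f x + (f y - f 1)) by ring.
      apply is_derive_scal.
      apply (is_derive_plus H (fun t => (f y - f 1) * t)); [now apply hH|].
      auto_derive; [exact I | ring]. }
  rewrite Rmult_1_l in e.
  replace (H (2 * y) - H y) with (y * (H 2 - H 1 + (f y - f 1))) by lra.
  field; lra.
Qed.

Lemma log_additive_derivative_differentiable (H f : R -> R) :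
  has_derivative_on_pos H f ->
  (forall x y, 0 < x -> 0 < y -> f (x * y) = f x + f y - f 1) ->
  forall y, 0 < y -> ex_derive f y.
Proof.
  intros hH hf y hy.
  apply ex_derive_ext_loc
    with (fun t => (H (2 * t) - H t) / t + (f 1 - H 2 + H 1)).
  - apply filter_imp with (2 := open_gt 0 y hy).
    intros t ht; symmetry.
    now apply log_additive_derivative_formula.
  - auto_derive.
    repeat split; try lra.
    + exists (f (2 * y)); apply hH; lra.
    + exists (f y); now apply hH.
Qed.

(** Differentiating [f (t * y) = f t + f y - f 1] in [t] at [t = 1] gives
    [y * f' y = f' 1], so [f] and [f' 1 * ln] have the same derivative. *)
Lemma log_additive_differentiable (f : R -> R) :
  (forall y, 0 < y -> ex_derive f y) ->
  (forall x y, 0 < x -> 0 < y -> f (x * y) = f x + f y - f 1) ->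
  forall x, 0 < x -> f x = f 1 + Derive f 1 * ln x.
Proof.
  intros df hf x hx.
  assert (e : f x - Derive f 1 * ln x = f 1 - Derive f 1 * ln 1).
  { apply (has_derivative_on_pos_unique_primitive
      f (fun t => Derive f 1 * ln t) (fun t => Derive f 1 / t)); try lra.
    - intros y hy.
      assert (scaled : y * Derive f y = Derive f 1).
      { assert (d1 : is_derive (fun t => f (t * y)) 1 (y * Derive f y)).
        { apply is_derive_dilate.
          rewrite Rmult_1_l.
          now apply Derive_correct, df. }
        assert (d2 : is_derive (fun t => f (t * y)) 1 (Derive f 1)).
        { apply is_derive_ext_loc with (fun t => f t + (f y - f 1)).
          - apply filter_imp with (2 := open_gt 0 1 Rlt_0_1).
            intros t ht.
            symmetry; rewrite (hf t y ht hy); apply Rplus_assoc.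
          - auto_derive; [apply df; lra | apply Rmult_1_l]. }
        rewrite <- (is_derive_unique _ _ _ d1).
        now apply is_derive_unique. }
      replace (Derive f 1 / y) with (Derive f y)
        by (rewrite <- scaled; field; lra).
      now apply Derive_correct, df.
    - intros t ht.
      auto_derive; [exact ht | field; lra]. }
  rewrite ln_1 in e; lra.
Qed.

Theorem mainTheorem4 (H H' : R -> R) (hH : has_derivative_on_pos H H') :
  (exists lambda mu : R -> R,
     forall mx my : R, 0 < mx -> 0 < my ->
       H' (mx * my) = lambda mx + mu my)
  <->
  (exists A B C : R,
     forall m : R, 0 < m ->
       H m = A + B * m + C * (m * ln m - m)).
Proof.
  split.
  - intros [lambda [mu hlm]].
    assert (hf : forall x y, 0 < x -> 0 < y -> H' (x * y) = H' x + H' y - H' 1).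
    { intros x y hx hy.
      assert (ex := hlm x 1 hx Rlt_0_1).
      assert (ey := hlm 1 y Rlt_0_1 hy).
      assert (e1 := hlm 1 1 Rlt_0_1 Rlt_0_1).
      rewrite Rmult_1_r in ex, e1.
      rewrite Rmult_1_l in ey.
      rewrite (hlm x y hx hy); lra. }
    assert (f_log := log_additive_differentiable H'
      (log_additive_derivative_differentiable H H' hH hf) hf).
    set (B := H' 1) in *.
    set (C := Derive H' 1) in *.
    (* [B - C] is the value at 1 of B * m + C * (m * ln m - m). *)
    exists (H 1 - (B - C)), B, C.
    intros m hm.
    assert (e : H m - (0 + B * m + C * (m * ln m - m))
              = H 1 - (0 + B * 1 + C * (1 * ln 1 - 1))).
    { apply (has_derivative_on_pos_unique_primitive
        H (fun t => 0 + B * t + C * (t * ln t - t)) H'); try lra.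
      - exact hH.
      - intros t ht.
        rewrite (f_log t ht).
        now apply has_derivative_on_pos_affine_log. }
    rewrite ln_1 in e; lra.
  - intros [A [B [C hABC]]].
    assert (f_log : forall m, 0 < m -> H' m = B + C * ln m).
    { intros m hm.
      rewrite <- (is_derive_unique _ _ _ (hH m hm)).
      apply is_derive_unique.
      apply is_derive_ext_loc with (fun t => A + B * t + C * (t * ln t - t)).
      - apply filter_imp with (2 := open_gt 0 m hm).
        intros t ht; symmetry; now apply hABC.
      - now apply has_derivative_on_pos_affine_log. }
    exists (fun x => B + C * ln x), (fun y => C * ln y).
    intros x y hx hy.
    rewrite f_log, ln_mult by (try apply Rmult_lt_0_compat; assumption).
    ring.
Qed.
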